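(* Let $n\in\mathbb N$ and regard $L_n^{(0)}$ as an $\Re$-module via $\sharp$. Then: (i) if $n$ is odd, $L_n^{(0)}$ is isomorphic to the irreducible $\Re$-module $R_{\frac{n-1}{2}}(-\frac14,-\frac14,-\frac14)$; (ii) if $n=0$, $L_n^{(0)}$ is isomorphic to the irreducible $\Re$-module $R_0(-\frac12,-\frac12,-\frac12)$; (iii) if $n\neq0$ and $n\equiv0\pmod 4$, $L_n^{(0)}$ is isomorphic to the direct sum of the irreducible $\Re$-modules $R_{\frac n4-1}(\frac{n-4}{8},\frac n8,\frac{n-4}{8})$ and $R_{\frac n4}(\frac{n-4}{8},\frac{n-4}{8},\frac{n-4}{8})$; (iv) if $n\equiv2\pmod 4$, $L_n^{(0)}$ is isomorphic to the direct sum of the irreducible $\Re$-modules $R_{\frac{n-2}{4}}(\frac{n-6}{8},\frac{n-2}{8},\frac{n-2}{8})$ and $R_{\frac{n-2}{4}}(\frac{n-2}{8},\frac{n-2}{8},\frac{n-6}{8})$.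
   Context: $U(\mathfrak{sl}_2)$ is the $\mathbb C$-algebra generated by $E,F,H$ with $[H,E]=2E$, $[H,F]=-2F$, $[E,F]=H$. For $n\in\mathbb N$, $L_n$ is the $(n+1)$-dimensional $U(\mathfrak{sl}_2)$-module with basis $v_0,\dots,v_n$ such that $Ev_i=(n-i+1)v_{i-1}$ ($1\le i\le n$), $Ev_0=0$, $Fv_i=(i+1)v_{i+1}$ ($0\le i\le n-1$), $Fv_n=0$, $Hv_i=(n-2i)v_i$. Let $L_n^{(0)}=\mathrm{span}\{v_i: i \text{ even}\}$ and (for $n\ge1$) $L_n^{(1)}=\mathrm{span}\{v_i: i\text{ odd}\}$. $\Re$ is generated by $A,B,C,\Delta$ with $[A,B]=[B,C]=[C,A]=2\Delta$ and $\alpha=[A,\Delta]+AC-BA$, $\beta=[B,\Delta]+BA-CB$, $\gamma=[C,\Delta]+CB-AC$ central; $\delta=A+B+C$. $\sharp:\Re\to U(\mathfrak{sl}_2)$ is the algebra homomorphism with $A\mapsto \frac{(E+F-2)(E+F+2)}{16}$, $B\mapsto\frac{(H-2)(H+2)}{16}$, $C\mapsto\frac{(\mathbf iE-\mathbf iF-2)(\mathbf iE-\mathbf iF+2)}{16}$, $\Delta\mapsto\frac{(H+2)F^2-(H-2)E^2}{64}$ ($\mathbf i=\sqrt{-1}$); its image preserves $L_n^{(0)}$ and $L_n^{(1)}$, making them $\Re$-modules. For $a,b,c\in\mathbb C$, $d\in\mathbb N$, $R_d(a,b,c)$ is the $(d+1)$-dimensional $\Re$-module (determined up to isomorphism) with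 a basis in which $A$ is lower bidiagonal with diagonal $\theta_i=(a+\frac d2-i)(a+\frac d2-i+1)$ and subdiagonal entries $1$, $B$ is upper bidiagonal with diagonal $\theta^*_i=(b+\frac d2-i)(b+\frac d2-i+1)$ and superdiagonal $\varphi_i=i(i-d-1)(a+b+c+\frac d2-i+2)(a+b-c+\frac d2-i+1)$, and $\alpha,\beta,\gamma,\delta$ act as the scalars $(c-b)(c+b+1)(a-\frac d2)(a+\frac d2+1)$, $(a-c)(a+c+1)(b-\frac d2)(b+\frac d2+1)$, $(b-a)(b+a+1)(c-\frac d2)(c+\frac d2+1)$, $\frac d2(\frac d2+1)+a(a+1)+b(b+1)+c(c+1)$. *)

(* Defs.v *)
(* Field of scalars: an arbitrary numClosedFieldType C
   (algebraically closed, char 0, with 'i); this includes the complex numbers. *)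
From HB Require Import structures.
From mathcomp Require Import all_boot all_order all_algebra.
Set Implicit Arguments. Unset Strict Implicit. Unset Printing Implicit Defensive.
Import Order.TTheory GRing.Theory Num.Theory.
Local Open Scope ring_scope.

(* Matrices act on COLUMN vectors: entry (r, c) of X is the coefficient of
   v_r in X v_c. *)

(* A finite-dimensional representation of the Racah algebra: images of
   the generators A, B, C, Delta. *)
Record RMod (C : fieldType) (m : nat) := MkRMod {
  rA : 'M[C]_m; rB : 'M[C]_m; rC : 'M[C]_m; rD : 'M[C]_m }.

(* The sl2 module L_n, basis v_0..v_n *)
Definition Emx (C : fieldType) (n : nat) : 'M[C]_n.+1 :=
  \matrix_(r, c) (if (r.+1 == c :> nat) then (n.+1 - c)%:R else 0).
Definition Fmx (C : fieldType) (n : nat) : 'M[C]_n.+1 :=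
  \matrix_(r, c) (if (r == c.+1 :> nat) then (c.+1)%:R else 0).
Definition Hmx (C : fieldType) (n : nat) : 'M[C]_n.+1 :=
  \matrix_(r, c) (if (r == c :> nat) then n%:R - (2 * c)%:R else 0).

Definition Asharp (C : numClosedFieldType) n : 'M[C]_n.+1 :=
  let X := Emx C n + Fmx C n in
  (16 : C)^-1 *: ((X - 2%:M) *m (X + 2%:M)).
Definition Bsharp (C : numClosedFieldType) n : 'M[C]_n.+1 :=
  let X := Hmx C n in
  (16 : C)^-1 *: ((X - 2%:M) *m (X + 2%:M)).
Definition Csharp (C : numClosedFieldType) n : 'M[C]_n.+1 :=
  let X := 'i *: Emx C n - 'i *: Fmx C n in
  (16 : C)^-1 *: ((X - 2%:M) *m (X + 2%:M)).
Definition Dsharp (C : numClosedFieldType) n : 'M[C]_n.+1 :=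
  let E := Emx C n in let F := Fmx C n in let H := Hmx C n in
  (64 : C)^-1 *: ((H + 2%:M) *m F *m F - (H - 2%:M) *m E *m E).

(* restriction to L_n^(0) = span{v_i : i even}, basis v_0, v_2, ..., v_{2 (n/2)} *)
Definition evenpart (C : fieldType) n (X : 'M[C]_n.+1) : 'M[C]_((n./2).+1) :=
  \matrix_(i, j) X (inord (2 * i)) (inord (2 * j)).

Definition Lmod0 (C : numClosedFieldType) n : RMod C ((n./2).+1) :=
  MkRMod (evenpart (Asharp C n)) (evenpart (Bsharp C n))
         (evenpart (Csharp C n)) (evenpart (Dsharp C n)).

(* The module R_d(a,b,c), basis w_0..w_d.  A, B as given; delta acts as the
   scalar del, hence C = del - A - B, and Delta = [A,B]/2. *)
Definition Rmod (C : fieldType) (d : nat) (a b c : C) : RMod C d.+1 :=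
  let h := d%:R / 2 in
  let theta (i : nat) := (a + h - i%:R) * (a + h - i%:R + 1) in
  let thetas (i : nat) := (b + h - i%:R) * (b + h - i%:R + 1) in
  let phi (i : nat) := i%:R * (i%:R - d%:R - 1) * (a + b + c + h - i%:R + 2)
                        * (a + b - c + h - i%:R + 1) in
  let A : 'M[C]_d.+1 := \matrix_(r, s)
     (if (r == s :> nat) then theta s else if (r == s.+1 :> nat) then 1 else 0) in
  let B : 'M[C]_d.+1 := \matrix_(r, s)
     (if (r == s :> nat) then thetas s else if (r.+1 == s :> nat) then phi s else 0) in
  let del := h * (h + 1) + a * (a + 1) + b * (b + 1) + c * (c + 1) in
  MkRMod A B (del%:M - A - B) ((2 : C)^-1 *: (A *m B - B *m A)).

Definition dsum (C : fieldType) m1 m2 (M1 : RMod C m1) (M2 : RMod C m2)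
  : RMod C (m1 + m2) :=
  MkRMod (block_mx (rA M1) 0 0 (rA M2)) (block_mx (rB M1) 0 0 (rB M2))
         (block_mx (rC M1) 0 0 (rC M2)) (block_mx (rD M1) 0 0 (rD M2)).

Definition isoR (C : fieldType) m1 m2 (M1 : RMod C m1) (M2 : RMod C m2) : Prop :=
  exists P : 'M[C]_(m2, m1), (row_free P && row_full P) /\
   [/\ P *m rA M1 = rA M2 *m P, P *m rB M1 = rB M2 *m P,
    P *m rC M1 = rC M2 *m P & P *m rD M1 = rD M2 *m P].

(* The column-vector subspace spanned by the columns of U^T (= rows of U)
   is invariant under X iff (U *m X^T <= U)%MS. *)
Definition rinvariant (C : fieldType) m (M : RMod C m) (U : 'M[C]_m) : Prop :=
  [/\ (U *m (rA M)^T <= U)%MS, (U *m (rB M)^T <= U)%MS,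
      (U *m (rC M)^T <= U)%MS & (U *m (rD M)^T <= U)%MS].

Definition rirreducible (C : fieldType) m (M : RMod C m) : Prop :=
  (0 < m)%N /\
  forall U : 'M[C]_m, rinvariant M U -> \rank U = 0%N \/ row_full U.

Arguments Rmod : clear implicits.
Arguments Lmod0 : clear implicits.

(* Main.v *)
Require Import Defs.
From HB Require Import structures.
From mathcomp Require Import all_boot all_order all_algebra.
From mathcomp Require Import ring zify.
Import Order.TTheory GRing.Theory Num.Theory.
Local Open Scope ring_scope.

(** On the even part of L_n the operator B is diagonal and A is tridiagonal, while
   C = del - A - B and Delta = [A, B]/2, so only A and B have to be intertwined.
   For n odd the eigenvalues of B are distinct.  For n even the flip
   v_i <-> v_(n-i) commutes with A and B, and splits the even part into an
   antisymmetric and a symmetric summand on which A is again tridiagonal and B is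
   diagonal with distinct eigenvalues.  Expressing the B-eigenvectors of
   R_d(a,b,c) in its split basis w_0, ..., w_d gives a triangular matrix of
   products, and it intertwines A with its tridiagonal form by a rational
   identity in the indices.  Irreducibility is then clear: an invariant subspace is
   spanned by eigenvectors of B, and A connects neighbouring ones. *)

(** * Tridiagonal matrices *)

(** All three sequences are indexed by the column, so column s lists the image of the basis vector
    v_s. Entries are functions on [nat], so that neighbouring and reflected indices need no
    ordinals. *)
Definition tri {C : fieldType} (sub diag sup : nat -> C) (r s : nat) : C :=
  if r == s then diag s else if r == s.+1 then sub s
  else if r.+1 == s then sup s else 0.

Definition trimx {C : fieldType} d (sub diag sup : nat -> C) : 'M[C]_d.+1 :=
  \matrix_(r, s) tri sub diag sup r s.

(** The shape shared by L_n^(0) and R_d(a,b,c): C comes from the scalar action of delta, and Delta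
    is half of [A, B]. *)
Definition racah {C : fieldType} {m} (A B : 'M[C]_m) (del : C) : RMod C m :=
  MkRMod A B (del%:M - A - B) (2^-1 *: (A *m B - B *m A)).

Section Tridiagonal.
Variable C : fieldType.
Implicit Types (sub diag sup : nat -> C).

Lemma sum_ord_eq m (f : nat -> C) (k : nat) :
  \sum_(j < m) (if j == k :> nat then f j else 0) = if (k < m)%N then f k else 0.
Proof.
case: ltnP => Hk.
  rewrite (bigD1 (Ordinal Hk)) //= eqxx big1 ?addr0 // => j Hj.
  by case: eqP => // E; case/eqP: Hj; apply: val_inj.
by apply: big1 => j _; case: eqP => // E; have := ltn_ord j; lia.
Qed.

Lemma triE sub diag sup r s : tri sub diag sup r s =
  (if r == s then diag s else 0) + (if r == s.+1 then sub s else 0)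
  + (if r.+1 == s then sup s else 0).
Proof.
by rewrite /tri; do 3 case: eqP => ?; rewrite ?addr0 ?add0r //; lia.
Qed.

Lemma mulmx_trimx m d (f : nat -> nat -> C) sub diag sup (i : 'I_m) (j : 'I_d.+1) :
  ((\matrix_(r < m, s < d.+1) f r s) *m trimx d sub diag sup) i j =
  (if (0 < j)%N then f i j.-1 * sup j else 0) + f i j * diag j
  + (if (j < d)%N then f i j.+1 * sub j else 0).
Proof.
rewrite mxE.
under eq_bigr => k _ do rewrite !mxE triE !mulrDr.
rewrite !big_split /= -[RHS]addrA [RHS]addrC; congr (_ + _ + _).
- transitivity (\sum_(k < d.+1) if k == j :> nat then f i k * diag j else 0).
    by apply: eq_bigr => k _; case: eqP; rewrite ?mulr0.
  by rewrite (sum_ord_eq _ (fun k => f i k * diag j)) ltn_ord.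
- transitivity (\sum_(k < d.+1) if k == j.+1 :> nat then f i k * sub j else 0).
    by apply: eq_bigr => k _; case: eqP; rewrite ?mulr0.
  by rewrite (sum_ord_eq _ (fun k => f i k * sub j)) ltnS.
(* For j = 0 there is no left neighbour; the out-of-range index [d.+1] then makes the sum zero. *)
- transitivity (\sum_(k < d.+1)
      if k == (if (0 < j)%N then j.-1 else d.+1) :> nat then f i k * sup j else 0).
    apply: eq_bigr => k _; have := ltn_ord k; have := ltn_ord j => Hj Hk.
    by case: (ltnP 0 j) => H; do 2 case: eqP => ?; rewrite ?mulr0 //; lia.
  rewrite (sum_ord_eq _ (fun k => f i k * sup j)); case: (ltnP 0 j) => H; last by rewrite ltnn.
  by have -> : (j.-1 < d.+1)%N by have := ltn_ord j; lia.
Qed.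

Lemma trimx_mulmx m d (f : nat -> nat -> C) sub diag sup (i : 'I_d.+1) (j : 'I_m) :
  (trimx d sub diag sup *m (\matrix_(r < d.+1, s < m) f r s)) i j =
  (if (0 < i)%N then sub i.-1 * f i.-1 j else 0) + diag i * f i j
  + (if (i < d)%N then sup i.+1 * f i.+1 j else 0).
Proof.
rewrite mxE.
under eq_bigr => k _ do rewrite !mxE triE !mulrDl.
rewrite !big_split /= [X in X + _]addrC; congr (_ + _ + _).
- transitivity (\sum_(k < d.+1)
      if k == (if (0 < i)%N then i.-1 else d.+1) :> nat then sub k * f k j else 0).
    apply: eq_bigr => k _; have := ltn_ord k; have := ltn_ord i => Hj Hk.
    by case: (ltnP 0 i) => H; do 2 case: eqP => ?; rewrite ?mul0r //; lia.
  rewrite (sum_ord_eq _ (fun k => sub k * f k j)); case: (ltnP 0 i) => H; last by rewrite ltnn.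
  by have -> : (i.-1 < d.+1)%N by have := ltn_ord i; lia.
- transitivity (\sum_(k < d.+1) if k == i :> nat then diag k * f k j else 0).
    by apply: eq_bigr => k _; rewrite eq_sym; case: eqP; rewrite ?mul0r.
  by rewrite (sum_ord_eq _ (fun k => diag k * f k j)) ltn_ord.
- transitivity (\sum_(k < d.+1) if k == i.+1 :> nat then sup k * f k j else 0).
    by apply: eq_bigr => k _; rewrite eq_sym; case: eqP; rewrite ?mul0r.
  by rewrite (sum_ord_eq _ (fun k => sup k * f k j)) ltnS.
Qed.

Lemma trimx_diag d (f : nat -> C) :
  trimx d (fun=> 0) f (fun=> 0) = diag_mx (\row_i f i).
Proof.
apply/matrixP => i j; rewrite !mxE /tri !if_same -val_eqE /=.
by case: eqP => [->|]; rewrite ?mulr1n.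
Qed.

(** Lagrange interpolation: the product of B - f j over all j <> k kills every component of u but
    the k-th, which it multiplies by a nonzero scalar because the f j are distinct. *)
Lemma eigen_component {d} (f : nat -> C) (U : 'M[C]_d.+1) (u : 'rV[C]_d.+1) k :
  (forall i j : 'I_d.+1, f i = f j -> i = j) ->
  (U *m (trimx d (fun=> 0) f (fun=> 0))^T <= U)%MS -> (u <= U)%MS ->
  u 0 k != 0 -> ((delta_mx 0 k : 'rV_d.+1) <= U)%MS.
Proof.
rewrite trimx_diag tr_diag_mx => f_inj UB uU uk.
have step (v : 'rV_d.+1) c : (v <= U)%MS -> ((v *m diag_mx (\row_i f i) - c *: v) <= U)%MS.
  move=> vU; rewrite addmx_sub // ?eqmx_opp ?scalemx_sub //.
  exact: submx_trans (submxMr _ vU) UB.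
have prods (s : seq 'I_d.+1) :
    ((\row_i (\prod_(j <- s) (f i - f j) * u 0 i))%R <= U)%MS.
  elim: s => [|j s IH].
    rewrite (_ : \row_i _ = u) //.
    by apply/rowP => i; rewrite !mxE big_nil mul1r.
  rewrite (_ : \row_i _ = (\row_i (\prod_(j <- s) (f i - f j) * u 0 i))
    *m diag_mx (\row_i f i) - f j *: \row_i (\prod_(j <- s) (f i - f j) * u 0 i)).
    exact: step.
  apply/rowP => i; rewrite mul_mx_diag !mxE big_cons; ring.
have prod_nz : \prod_(j <- rem k (enum 'I_d.+1)) (f k - f j) != 0.
  rewrite prodf_seq_neq0; apply/allP => j /=.
  rewrite mem_rem_uniq ?enum_uniq // inE => /andP[jk _].
  by rewrite subr_eq0; apply: contra jk => /eqP/f_inj ->.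
have := prods (rem k (enum 'I_d.+1)).
rewrite (_ : \row_i _ = (\prod_(j <- rem k (enum 'I_d.+1)) (f k - f j) * u 0 k)
    *: delta_mx 0 k).
  by rewrite eqmx_scale // mulf_neq0.
apply/rowP => i; rewrite !mxE eqxx /=; case: (eqVneq i k) => [->|ik].
  by rewrite mulr1.
rewrite (big_rem i) /=; last first.
  by rewrite mem_rem_uniq ?enum_uniq // inE ik mem_enum.
by rewrite subrr !mul0r mulr0.
Qed.

Lemma trimx_irreducible d sub diag sup (f : nat -> C) del :
  (forall j, (j < d)%N -> sub j != 0) ->
  (forall j, (0 < j <= d)%N -> sup j != 0) ->
  (forall i j : 'I_d.+1, f i = f j -> i = j) ->
  rirreducible (racah (trimx d sub diag sup) (trimx d (fun=> 0) f (fun=> 0)) del).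
Proof.
move=> sub_nz sup_nz f_inj; split=> // U [/= UA UB _ _].
case: (eqVneq U 0) => [->|U0]; [by left; rewrite mxrank0 | right].
have move_to (k l : 'I_d.+1) : ((delta_mx 0 k : 'rV_d.+1) <= U)%MS ->
    tri sub diag sup l k != 0 -> ((delta_mx 0 l : 'rV_d.+1) <= U)%MS.
  (* Row k of A^T is the image of v_k under A, and its l-th component is the given nonzero entry. *)
  move=> kU lk; apply: (eigen_component f U _ l f_inj UB
    (submx_trans (submxMr _ kU) UA)).
  by rewrite -rowE !mxE.
have [k0 k0U] : exists k, ((delta_mx 0 k : 'rV_d.+1) <= U)%MS.
  have [i [j Uij]] : exists i j, U i j != 0.
    case: (pickP (fun x => U x.1 x.2 != 0)) => [[i j] /= H|H]; first by exists i, j.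
    case/eqP: U0; apply/matrixP => i j; rewrite mxE.
    by apply/eqP/negPn; rewrite (H (i, j)).
  exists j; apply: (eigen_component f U (row i U) j f_inj UB (row_sub i U)).
  by rewrite mxE.
(* Induction on the distance e to k0: subdiagonal entries raise the index, superdiagonal ones lower
   it. *)
have near e : forall k : 'I_d.+1, (k = k0 + e :> nat)%N \/ (k + e = k0 :> nat)%N ->
    ((delta_mx 0 k : 'rV_d.+1) <= U)%MS.
  elim: e => [|e IH] k Hk.
    by have -> : k = k0 by apply: val_inj => /=; lia.
  have Hk1 := ltn_ord k; have Hk2 := ltn_ord k0.
  case: Hk => Hk.
    have Hl : (k.-1 < d.+1)%N by lia.
    apply: (move_to (Ordinal Hl)); first by apply: IH => /=; lia.
    rewrite /tri /=; case: ifP => ?; first lia.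
    by case: ifP => ?; [apply: sub_nz; lia | lia].
  have Hl : (k.+1 < d.+1)%N by lia.
  apply: (move_to (Ordinal Hl)); first by apply: IH => /=; lia.
  rewrite /tri /=; do 2 (case: ifP => ?; first lia).
  by rewrite eqxx; apply: sup_nz; lia.
rewrite -sub1mx; apply/row_subP => k; rewrite row1.
by case: (leqP k k0) => H; [apply: (near (k0 - k)%N) | apply: (near (k - k0)%N)]; lia.
Qed.

End Tridiagonal.

(** * Isomorphism and irreducibility of modules determined by A and B *)

Section Modules.
Variable C : fieldType.

(** U is pulled back along P. Subspaces are row spaces of transposed vectors, hence the inverse of
    P^T on the right. *)
Lemma irreducible_iso m (M1 M2 : RMod C m) :
  isoR M1 M2 -> rirreducible M1 -> rirreducible M2.
Proof.
move=> [P [/andP[Pfree _] [PA PB PC PD]]] [m_gt0 irr]; split=> // U [UA UB UC UD].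
have Pu : P^T \in unitmx by rewrite unitmx_tr -row_free_unit.
pose U' := U *m invmx P^T.
have inv X Y : P *m X = Y *m P -> (U *m Y^T <= U)%MS -> (U' *m X^T <= U')%MS.
  move=> E UY; rewrite /U'.
  have -> : U *m invmx P^T *m X^T = U *m Y^T *m invmx P^T.
    rewrite -!mulmxA; congr (_ *m _); apply: (can_inj (mulKmx Pu)).
    by rewrite !mulmxA mulmxV // mul1mx -trmx_mul -E trmx_mul -mulmxA mulmxV ?mulmx1.
  exact: submxMr.
have := irr U' (And4 (inv _ _ PA UA) (inv _ _ PB UB) (inv _ _ PC UC) (inv _ _ PD UD)).
by rewrite /row_full mxrankMfree // row_free_unit unitmx_inv.
Qed.

Lemma racah_iso m1 m2 (A1 B1 : 'M[C]_m1) (A2 B2 : 'M[C]_m2) del (P : 'M_(m2, m1)) :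
  row_free P && row_full P -> P *m A1 = A2 *m P -> P *m B1 = B2 *m P ->
  isoR (racah A1 B1 del) (racah A2 B2 del).
Proof.
move=> Pbij PA PB; exists P; split=> //; split=> //=.
  by rewrite !mulmxBr !mulmxBl PA PB scalar_mxC.
by rewrite -scalemxAr -scalemxAl mulmxBr mulmxBl !mulmxA PA PB -!mulmxA PA PB.
Qed.

Lemma dsum_racah m1 m2 (A1 B1 : 'M[C]_m1) (A2 B2 : 'M[C]_m2) del :
  dsum (racah A1 B1 del) (racah A2 B2 del) =
  racah (block_mx A1 0 0 A2) (block_mx B1 0 0 B2) del.
Proof.
rewrite /dsum /racah /=; congr MkRMod.
  by rewrite scalar_mx_block !opp_block_mx !add_block_mx !oppr0 !addr0.
rewrite !mulmx_block !mulmx0 !mul0mx !addr0 !add0r opp_block_mx add_block_mx.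
by rewrite scale_block_mx !oppr0 !addr0 !scaler0.
Qed.

Lemma Rmod_racah d (a b c : C) :
  Rmod C d a b c = racah
   (trimx d (fun=> 1) (fun i => (a + d%:R / 2 - i%:R) * (a + d%:R / 2 - i%:R + 1))
     (fun=> 0))
   (trimx d (fun=> 0) (fun i => (b + d%:R / 2 - i%:R) * (b + d%:R / 2 - i%:R + 1))
     (fun i => i%:R * (i%:R - d%:R - 1) * (a + b + c + d%:R / 2 - i%:R + 2)
                        * (a + b - c + d%:R / 2 - i%:R + 1)))
   (d%:R / 2 * (d%:R / 2 + 1) + a * (a + 1) + b * (b + 1) + c * (c + 1)).
Proof.
rewrite /Rmod /racah /=.
congr MkRMod; do ?[congr (_ - _)]; do ?[congr (_ *: _)]; do ?[congr (_ - _)];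
  do ?[congr (_ *m _)]; do ?[congr (_ - _)]; apply/matrixP => i j;
  rewrite !mxE /tri; do 3 case: eqP => ? //; lia.
Qed.
End Modules.

(** * The intertwiner *)

Lemma natmul_neq0 {R : numDomainType} (x y : R) m :
  y != 0 -> x = m.+1%:R * y -> x != 0.
Proof. by move=> y0 ->; rewrite mulf_neq0 // pnatr_eq0. Qed.

Lemma natmulN_neq0 {R : numDomainType} (x y : R) m :
  y != 0 -> x = - (m.+1%:R * y) -> x != 0.
Proof. by move=> y0 ->; rewrite oppr_eq0 mulf_neq0 // pnatr_eq0. Qed.

(* Closes the side conditions of [field]: each factor is a constant multiple
   of a term known to be nonzero. *)
Ltac neq0_hyps :=
  repeat (apply/andP; split); try done;
  match goal with h : is_true (_ != 0) |- _ =>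
    first [ apply: (natmul_neq0 _ _ 0 h); ring | apply: (natmulN_neq0 _ _ 0 h); ring
          | apply: (natmul_neq0 _ _ 1 h); ring | apply: (natmulN_neq0 _ _ 1 h); ring
          | apply: (natmul_neq0 _ _ 3 h); ring | apply: (natmulN_neq0 _ _ 3 h); ring
          | apply: (natmul_neq0 _ _ 7 h); ring | apply: (natmulN_neq0 _ _ 7 h); ring ]
  end.

Section Intertwiner.
Variables (C : numFieldType) (d : nat) (sub diag sup theta thetas phi : nat -> C) (g : C).
(** A quadratic sequence, as in R_d(a,b,c) with g = 2b + d + 1. That differences split into linear
    factors makes the products below telescope. *)
Hypothesis thetasB : forall j k, thetas k - thetas j = (j%:R - k%:R) * (g - k%:R - j%:R).
Hypothesis phi0 : phi 0 = 0.
Hypothesis sub_neq0 : forall j, (j < d)%N -> sub j != 0.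
Hypothesis phi_neq0 : forall j, (0 < j <= d)%N -> phi j != 0.
Hypothesis g_neq : forall j k, (j <= k <= d)%N -> (j < d)%N -> g - k%:R - j%:R != 0.

(* The relation P A = A' P for the matrix P below, divided by its entry (i, k). *)
Hypothesis recurrence : forall i k, (i <= k <= d)%N ->
  diag k
  - (if (0 < k)%N then sub k.-1 * sup k * (k%:R - i%:R) * (g - 2 * k%:R + 2)
      * (g - 2 * k%:R + 1) / (phi k * (g - k%:R - i%:R + 1)) else 0)
  - (if (k < d)%N then phi k.+1 * (g - k%:R - i%:R)
      / ((k%:R - i%:R + 1) * (g - 2 * k%:R) * (g - 2 * k%:R - 1)) else 0)
  = theta i - phi i / ((k%:R - i%:R + 1) * (g - k%:R - i%:R + 1)).

(* Coefficient of w_i in the eigenvector of the upper bidiagonal matrix for the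
   eigenvalue [thetas k], normalised to be 1 for i = k. *)
Definition eigcoef (i k : nat) : C :=
  \prod_(i <= j < k) (phi j.+1 / (thetas k - thetas j)).

(** Dividing by the product of the [sub j] rescales the k-th eigenvector so that the subdiagonal
    [sub] is matched with the subdiagonal 1 of R_d(a,b,c). *)
Definition eigcoefn (i k : nat) : C :=
  if (i <= k)%N then eigcoef i k / \prod_(j < k) sub j else 0.

Let natB_neq0 i k : (i <= k)%N -> k%:R - i%:R + 1 != 0 :> C.
Proof. by move=> ik; rewrite -natrB // natr1 pnatr_eq0. Qed.

Lemma thetas_neq j k : (j < k <= d)%N -> thetas k - thetas j != 0.
Proof.
move=> jk; rewrite thetasB mulf_neq0 ?g_neq //; [|lia|lia].
by rewrite subr_eq0 eqr_nat; lia.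
Qed.

Lemma eigcoef_ltn i k : (i < k)%N ->
  eigcoef i k = phi i.+1 / (thetas k - thetas i) * eigcoef i.+1 k.
Proof. by move=> ik; rewrite /eigcoef big_ltn. Qed.

(** Every factor of the product depends on k, but by [thetasB] the linear factors for k + 1 are
    those for k with j shifted by one, so the quotient telescopes. *)
Lemma eigcoef_recr i k : (i <= k)%N -> (k < d)%N ->
  eigcoef i k.+1 =
  - (phi k.+1 * (g - k%:R - i%:R)
     / ((k%:R - i%:R + 1) * (g - 2 * k%:R) * (g - 2 * k%:R - 1))) * eigcoef i k.
Proof.
move=> ik kd; have [e ke] : exists e, (i + e = k)%N by exists (k - i)%N; lia.
have gk : g - 2 * k%:R != 0.
  by have := g_neq k k ltac:(lia) kd; congr (_ != _); ring.
have gk1 : g - 2 * k%:R - 1 != 0.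
  by have := g_neq k k.+1 ltac:(lia) kd; congr (_ != _); rewrite -natr1; ring.
elim: e i ik ke => [|e IH] i ik ke.
  have -> : i = k by lia.
  rewrite /eigcoef big_nat1 big_geq // thetasB -natr1; field.
  rewrite gk gk1 subrr add0r oner_eq0 opprD addrA subrr add0r oppr_eq0.
  by rewrite oner_eq0.
have ik' : (i < k)%N by lia.
rewrite eigcoef_ltn ?(ltnW ik') // IH ?[eigcoef i k]eigcoef_ltn //; try lia.
rewrite !thetasB.
have h1 : i%:R - k%:R != 0 :> C by rewrite subr_eq0 eqr_nat; lia.
have h2 : i%:R - k.+1%:R != 0 :> C by rewrite subr_eq0 eqr_nat; lia.
have h3 := g_neq i k ltac:(lia) ltac:(lia).
have h4 := g_neq i k.+1 ltac:(lia) ltac:(lia).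
have h5 : k%:R - i%:R + 1 != 0 :> C by exact: natB_neq0.
rewrite -!natr1 in h2 h4 *.
field; neq0_hyps.
Qed.

Lemma eigcoefn_gt i k : (k < i)%N -> eigcoefn i k = 0.
Proof. by rewrite /eigcoefn ltnNge => /negPf ->. Qed.

Lemma prod_sub_neq0 k : (k <= d)%N -> \prod_(j < k) sub j != 0.
Proof.
by move=> kd; apply/prodf_neq0 => j _; apply: sub_neq0; have := ltn_ord j; lia.
Qed.

(** Like [eigcoefn_succr] and [eigcoefn_predr], this writes a neighbour of the entry (i, k) as a
    multiple of that entry, so that P A = A' P reduces to [recurrence]. *)
Lemma eigcoefn_predl i k : (i <= k <= d)%N ->
  (if (0 < i)%N then eigcoefn i.-1 k else 0) =
  - (phi i / ((k%:R - i%:R + 1) * (g - k%:R - i%:R + 1))) * eigcoefn i k.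
Proof.
case: i => [|i] ik /=; first by rewrite phi0 !mul0r oppr0 mul0r.
rewrite /eigcoefn; have -> : (i <= k)%N by lia. have -> : (i < k)%N by lia.
rewrite eigcoef_ltn ?thetasB; last lia.
have h1 : i%:R - k%:R != 0 :> C by rewrite subr_eq0 eqr_nat; lia.
have h2 := g_neq i k ltac:(lia) ltac:(lia).
have h3 := prod_sub_neq0 k ltac:(lia).
rewrite -!natr1; field; neq0_hyps.
Qed.

Lemma eigcoefn_succr i k : (i <= k)%N -> (k < d)%N ->
  eigcoefn i k.+1 * sub k = - (phi k.+1 * (g - k%:R - i%:R)
     / ((k%:R - i%:R + 1) * (g - 2 * k%:R) * (g - 2 * k%:R - 1))) * eigcoefn i k.
Proof.
move=> ik kd; rewrite /eigcoefn ik leqW // eigcoef_recr // big_ord_recr /=.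
have h1 := sub_neq0 k kd; have h2 := prod_sub_neq0 k (ltnW kd).
by set x := - _; field; neq0_hyps.
Qed.

Lemma eigcoefn_predr i k : (i <= k <= d)%N ->
  (if (0 < k)%N then eigcoefn i k.-1 * sup k else 0) =
  - (if (0 < k)%N then sub k.-1 * sup k * (k%:R - i%:R) * (g - 2 * k%:R + 2)
      * (g - 2 * k%:R + 1) / (phi k * (g - k%:R - i%:R + 1)) else 0) * eigcoefn i k.
Proof.
case: k => [|k] ik /=; first by rewrite oppr0 mul0r.
(* On the diagonal the left neighbour lies below the diagonal and is 0, in agreement with the
   vanishing factor [k%:R - i%:R] of the statement. *)
case: (leqP i k) => ik'; last first.
  have -> : i = k.+1 by lia.
  by rewrite eigcoefn_gt // subrr mulr0 !mul0r oppr0 mul0r.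
have sk := sub_neq0 k ltac:(lia).
(* The recursion to the next column is read backwards, which puts [phi] into the denominator. *)
have -> : eigcoefn i k.+1 = eigcoefn i k.+1 * sub k / sub k by rewrite mulfK.
rewrite eigcoefn_succr //; last lia.
have h1 := phi_neq0 k.+1 ltac:(lia).
have h2 : g - k%:R - i%:R != 0 by apply: g_neq; lia.
have h3 : k%:R - i%:R + 1 != 0 :> C by exact: natB_neq0.
have h4 : g - 2 * k%:R != 0.
  by have := g_neq k k ltac:(lia) ltac:(lia); congr (_ != _); ring.
have h5 : g - 2 * k%:R - 1 != 0.
  by have := g_neq k k.+1 ltac:(lia) ltac:(lia); congr (_ != _); rewrite -natr1; ring.
rewrite -natr1; field; neq0_hyps.
Qed.

Definition eigmx : 'M[C]_d.+1 := \matrix_(i, k) eigcoefn i k.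

Lemma eigmx_unit : eigmx \in unitmx.
Proof.
rewrite -unitmx_tr unitmxE det_trig.
  rewrite unitfE; apply/prodf_neq0 => i _.
  rewrite !mxE /eigcoefn leqnn /eigcoef big_geq // mul1r invr_eq0.
  by rewrite prod_sub_neq0 // -ltnS.
by apply/is_trig_mxP => i j ij; rewrite !mxE eigcoefn_gt.
Qed.

Lemma eigmxA :
  eigmx *m trimx d sub diag sup = trimx d (fun=> 1) theta (fun=> 0) *m eigmx.
Proof.
apply/matrixP => i k; rewrite mulmx_trimx trimx_mulmx !mul0r !mul1r if_same addr0.
have := ltn_ord i; have := ltn_ord k; move: (i : nat) (k : nat) => {i k} i k.
rewrite !ltnS => kd id; case: (leqP i k) => ik.
  rewrite eigcoefn_predl ?ik // eigcoefn_predr ?ik //.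
  have -> : (if (k < d)%N then eigcoefn i k.+1 * sub k else 0) =
    - (if (k < d)%N then phi k.+1 * (g - k%:R - i%:R)
      / ((k%:R - i%:R + 1) * (g - 2 * k%:R) * (g - 2 * k%:R - 1)) else 0) * eigcoefn i k.
    case: ltnP => kd'; last by rewrite oppr0 mul0r.
    by rewrite eigcoefn_succr.
  rewrite [_ * diag k]mulrC -!mulrDl; congr (_ * _).
  by rewrite [RHS]addrC -recurrence ?ik // [_ + diag k]addrC.
(* Below the diagonal only the entry (k + 1, k) can be nonzero on either side; there the
   normalisation by the [sub j] gives equality. *)
rewrite (eigcoefn_gt i k) // mulr0 mul0r !addr0.
rewrite (_ : (if (0 < k)%N then _ else _) = 0) ?add0r; last first.
  by case: ifP => // _; rewrite eigcoefn_gt ?mul0r //; lia.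
have -> : (k < d)%N by lia. have -> : (0 < i)%N by lia.
case: (ltnP k.+1 i) => ik'.
  by rewrite !eigcoefn_gt ?mul0r //; lia.
have -> : i = k.+1 by lia.
rewrite /eigcoefn /= !leqnn /eigcoef !big_geq // big_ord_recr /= !mul1r.
by rewrite invfM -mulrA mulVf ?mulr1 ?sub_neq0 //; lia.
Qed.

Lemma eigmxB :
  eigmx *m trimx d (fun=> 0) thetas (fun=> 0) = trimx d (fun=> 0) thetas phi *m eigmx.
Proof.
apply/matrixP => i k; rewrite mulmx_trimx trimx_mulmx !mul0r !mulr0 !if_same !addr0 !add0r.
have := ltn_ord i; have := ltn_ord k; move: (i : nat) (k : nat) => {i k} i k.
rewrite !ltnS => kd id; case: (ltngtP i k) => ik.
- rewrite /eigcoefn ik (ltnW ik) eigcoef_ltn //.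
  have := thetas_neq i k ltac:(lia) => h; have := prod_sub_neq0 k kd => h'.
  have -> : (i < d)%N by lia.
  by field; rewrite h h'.
- rewrite !eigcoefn_gt ?mulr0 ?mul0r ?if_same ?addr0 //; lia.
- rewrite ik (eigcoefn_gt k.+1 k) ?mulr0 ?if_same ?addr0 //; exact: mulrC.
Qed.

Lemma thetas_inj (i j : 'I_d.+1) : thetas i = thetas j -> i = j.
Proof.
move=> E; apply: val_inj => /=; have := ltn_ord i; have := ltn_ord j => Hj Hi.
by case: (ltngtP i j) => // H; [have := thetas_neq i j ltac:(lia)
 | have := thetas_neq j i ltac:(lia)]; rewrite E subrr eqxx.
Qed.

End Intertwiner.

(** * The even part of L_n *)

Section EvenPart.
Variable C : numClosedFieldType.
Implicit Types n k : nat.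

(** On the vectors v_(2k) these are the entries of F^2/16, E^2/16, (EF + FE - 4)/16 and (H^2 -
    4)/16. [Ldel] is the scalar A + B + C, by the Casimir relation 2(EF + FE) + H^2 = n(n + 2). *)
Definition Lsub k : C := (2 * k%:R + 1) * (2 * k%:R + 2) / 16.
Definition Lsup n k : C := (n%:R - 2 * k%:R + 1) * (n%:R - 2 * k%:R + 2) / 16.
Definition Ldiag n k : C :=
  ((2 * k%:R + 1) * (n%:R - 2 * k%:R) + (n%:R - 2 * k%:R + 1) * (2 * k%:R) - 4) / 16.
Definition Lthetas n k : C := ((n%:R - 4 * k%:R) ^+ 2 - 4) / 16.
Definition Ldel n : C := (n%:R * (n%:R + 2) - 12) / 16.

Lemma EFmx n (p q : C) : p *: Emx C n + q *: Fmx C n =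
  trimx n (fun k => q * k.+1%:R) (fun=> 0) (fun k => p * (n%:R + 1 - k%:R)).
Proof.
apply/matrixP => i j; rewrite !mxE triE if_same add0r addrC.
congr (_ + _); case: eqP; rewrite ?mulr0 // => _.
by rewrite natrB ?natr1 // ltnW.
Qed.

Lemma HmxE n : Hmx C n = trimx n (fun=> 0) (fun k => n%:R - 2 * k%:R) (fun=> 0).
Proof. by apply/matrixP => i j; rewrite !mxE /tri !if_same natrM. Qed.

Lemma trimxD_scalar n (sub diag sup : nat -> C) x :
  trimx n sub diag sup + x%:M = trimx n sub (fun k => diag k + x) sup.
Proof.
apply/matrixP => i j; rewrite !mxE /tri -val_eqE /=.
by case: eqP; rewrite ?addr0.
Qed.

(** One computation of (X^2 - 4)/16 for A, with p = q = 1, and for C, with p = i and q = -i. *)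
Lemma evenpart_square n (p q : C) (X := p *: Emx C n + q *: Fmx C n) :
  evenpart (16^-1 *: ((X - 2%:M) *m (X + 2%:M))) =
  trimx n./2 (fun k => q ^+ 2 * Lsub k) (fun k => (p * q * (16 * Ldiag n k + 4) - 4) / 16)
    (fun k => p ^+ 2 * Lsup n k).
Proof.
have -> : - 2%:M = (-2)%:M :> 'M[C]_n.+1 by rewrite raddfN.
apply/matrixP => i j; rewrite /X EFmx !trimxD_scalar [LHS]mxE [LHS]mxE mulmx_trimx.
have := ltn_ord i; have := ltn_ord j => Hj Hi.
rewrite mxE !inordK; [|lia|lia].
move: Hi Hj; move: (i : nat) (j : nat) => {i j} i j Hi Hj.
(* At the last index with 2j = n there is no v_(n+1); the term (2j + 1)(n - 2j) of [Ldiag] vanishes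
   there as well. *)
have nE : ~~ (2 * j < n)%N -> n%:R = 2 * j%:R :> C.
  by move=> h; rewrite -natrM; congr _%:R; lia.
have j2 : (0 < 2 * j)%N = (0 < j)%N by lia.
rewrite /tri j2; case: j Hj nE j2 => [|j] Hj nE _.
{ rewrite /=; repeat (case: ifP => ?; try (exfalso; lia)).
  all: rewrite /Ldiag /Lsub /Lsup.
  all: try (have -> : i = 0%N by lia); try (have -> : i = 1%N by lia).
  all: try (rewrite nE; last lia).
  all: by field. }
have -> : (2 * j.+1).-1 = (2 * j).+1 by lia.
rewrite /=; repeat (case: ifP => ?; try (exfalso; lia)).
all: rewrite /Ldiag /Lsub /Lsup.
all: try (rewrite nE; last lia).
all: by field.
Qed.

Lemma evenpart_Asharp n :
  evenpart (Asharp C n) = trimx n./2 Lsub (Ldiag n) (Lsup n).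
Proof.
rewrite /Asharp -[Emx C n]scale1r -[Fmx C n]scale1r evenpart_square.
apply/matrixP => i j; rewrite !mxE /tri /Ldiag.
by repeat case: ifP => _ //; field.
Qed.

Lemma evenpart_Bsharp n :
  evenpart (Bsharp C n) = trimx n./2 (fun=> 0) (Lthetas n) (fun=> 0).
Proof.
rewrite /Bsharp; have -> : - 2%:M = (-2)%:M :> 'M[C]_n.+1 by rewrite raddfN.
apply/matrixP => i j; rewrite HmxE !trimxD_scalar [LHS]mxE [LHS]mxE mulmx_trimx.
have := ltn_ord i; have := ltn_ord j => Hj Hi.
rewrite mxE !inordK; [|lia|lia].
move: Hi Hj; move: (i : nat) (j : nat) => {i j} i j Hi Hj.
rewrite !mulr0 !if_same addr0 add0r /tri !if_same /Lthetas.
have -> : (2 * i == 2 * j)%N = (i == j) by lia.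
by case: ifP => // _; field.
Qed.

(** Since p^2 = q^2 = -1 and pq = 1, C has the diagonal of A and the opposite off-diagonal entries.
    So A + C is diagonal, and adding B gives the Casimir scalar. *)
Lemma evenpart_Csharp n : evenpart (Csharp C n) =
  (Ldel n)%:M - evenpart (Asharp C n) - evenpart (Bsharp C n).
Proof.
rewrite evenpart_Asharp evenpart_Bsharp /Csharp -scaleNr evenpart_square.
apply/matrixP => i j; rewrite !mxE /tri -val_eqE /= !if_same mulrN -expr2 sqrrN sqrCi.
rewrite /Ldel /Lthetas /Ldiag /Lsub /Lsup.
by repeat case: ifP => _ //; rewrite ?mulr1n ?mulr0n; field.
Qed.

(** B is diagonal, so [A, B] multiplies the off-diagonal entries of A by differences of consecutive
    eigenvalues; these are the factors H + 2 and H - 2 up to constants. *)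
Lemma evenpart_Dsharp n (A := evenpart (Asharp C n)) (B := evenpart (Bsharp C n)) :
  evenpart (Dsharp C n) = 2^-1 *: (A *m B - B *m A).
Proof.
rewrite /A /B evenpart_Asharp evenpart_Bsharp /Dsharp.
have EE : Emx C n = trimx n (fun=> 0) (fun=> 0) (fun k => n%:R + 1 - k%:R).
  have := EFmx n 1 0; rewrite scale1r scale0r addr0 => ->.
  by apply/matrixP => i j; rewrite !mxE /tri mul0r mul1r.
have FE : Fmx C n = trimx n (fun k => k.+1%:R) (fun=> 0) (fun=> 0).
  have := EFmx n 0 1; rewrite scale1r scale0r add0r => ->.
  by apply/matrixP => i j; rewrite !mxE /tri mul0r mul1r.
have -> : - 2%:M = (-2)%:M :> 'M[C]_n.+1 by rewrite raddfN.
(* The entries are those of FH = (H + 2)F, and below those of EH = (H - 2)E. *)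
have HF : (Hmx C n + 2%:M) *m Fmx C n = trimx n
    (fun k => (n%:R - 2 * k%:R) * k.+1%:R) (fun=> 0) (fun=> 0).
  apply/matrixP => i j; rewrite HmxE FE trimxD_scalar trimx_mulmx mxE.
  rewrite !mul0r !if_same addr0 add0r /tri !if_same.
  case: (eqVneq (i : nat) j) => [-> | _]; first by rewrite mulr0.
  case: eqP => [->|]; last by rewrite mulr0.
  by field.
have HE' : (Hmx C n + (-2)%:M) *m Emx C n = trimx n (fun=> 0) (fun=> 0)
    (fun k => (n%:R - 2 * k%:R) * (n%:R + 1 - k%:R)).
  apply/matrixP => i j; rewrite HmxE EE trimxD_scalar trimx_mulmx mxE.
  rewrite !mul0r !if_same addr0 add0r /tri.
  case: (eqVneq (i : nat) j) => [-> | _]; first by rewrite mulr0.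
  case: eqP => [_|_]; first by rewrite mulr0.
  by case: eqP => [<-|]; [field | rewrite mulr0].
rewrite HF HE' EE FE; apply/matrixP => i j.
rewrite [LHS]mxE [LHS]mxE [X in _ * X]mxE [X in _ + X]mxE !mulmx_trimx.
rewrite [RHS]mxE [X in _ = _ * X]mxE [X in _ = _ * (_ + X)]mxE mulmx_trimx trimx_mulmx.
rewrite !mulr0 !mul0r !if_same !addr0 !add0r.
have := ltn_ord i; have := ltn_ord j => Hj Hi.
rewrite !inordK; [|lia|lia].
move: Hi Hj; move: (i : nat) (j : nat) => {i j} i j Hi Hj.
have [->|j0] := posnP j.
{ rewrite /tri /=; repeat (case: ifP => ?; try (exfalso; lia)).
  all: rewrite /Lthetas /Lsub /Lsup /Ldiag.
  all: try (have -> : i = 0%N by lia); try (have -> : i = 1%N by lia).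
  all: by field. }
have [j' E] : exists j', j = j'.+1 by exists j.-1; lia.
subst j.
have -> : (2 * j'.+1).-1 = (2 * j').+1 by lia.
rewrite /tri /=; repeat (case: ifP => ?; try (exfalso; lia)).
all: rewrite /Lthetas /Lsub /Lsup /Ldiag.
all: try (have -> : i = j'.+1 by lia); try (have -> : i = j'.+2 by lia).
all: try (have -> : i = j' by lia).
all: by field.
Qed.

Lemma Lmod0E n : Lmod0 C n =
  racah (trimx n./2 Lsub (Ldiag n) (Lsup n)) (trimx n./2 (fun=> 0) (Lthetas n) (fun=> 0))
    (Ldel n).
Proof.
rewrite /Lmod0 evenpart_Csharp evenpart_Dsharp.
by rewrite -evenpart_Asharp -evenpart_Bsharp.
Qed.
End EvenPart.

(** * Folding *)

Section IsoR.
Variable C : fieldType.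

Lemma isoR_trans m1 m2 m3 (M1 : RMod C m1) (M2 : RMod C m2) (M3 : RMod C m3) :
  isoR M1 M2 -> isoR M2 M3 -> isoR M1 M3.
Proof.
move=> [P [/andP[Pfree Pfull] [PA PB PC PD]]] [Q [/andP[Qfree Qfull] [QA QB QC QD]]].
exists (Q *m P); split.
  rewrite /row_free /row_full mxrankMfree //; apply/andP; split=> //.
  move: Pfree Pfull Qfull; rewrite /row_free /row_full => /eqP e1 /eqP e2 /eqP e3.
  by rewrite e3 -e1 e2.
by split; rewrite -mulmxA ?PA ?PB ?PC ?PD mulmxA ?QA ?QB ?QC ?QD -mulmxA.
Qed.

Lemma isoR_dsum m1 m2 m1' m2' (M1 : RMod C m1) (M2 : RMod C m2)
    (M1' : RMod C m1') (M2' : RMod C m2') :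
  isoR M1 M1' -> isoR M2 M2' -> isoR (dsum M1 M2) (dsum M1' M2').
Proof.
move=> [P [/andP[Pfree Pfull] [PA PB PC PD]]] [Q [/andP[Qfree Qfull] [QA QB QC QD]]].
exists (block_mx P 0 0 Q); split.
  rewrite /row_free /row_full rank_diag_block_mx; move: Pfree Pfull Qfree Qfull.
  rewrite /row_free /row_full => /eqP e1 /eqP e2 /eqP e3 /eqP e4.
  by rewrite {1}e1 {1}e3 {1}e2 {1}e4 !eqxx.
by split; rewrite /= !mulmx_block !mulmx0 !mul0mx !addr0 !add0r ?PA ?PB ?PC ?PD
  ?QA ?QB ?QC ?QD.
Qed.
End IsoR.

Section Folding.
Variable C : numFieldType.

(* Row r sends v_r to 1 and v_(N-r) to e; at a fixed index r = N - r the entry is 1 + e. *)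
Definition foldmx D N (e : C) : 'M[C]_(D, N.+1) :=
  \matrix_(r, c) ((if c == r :> nat then 1 else 0)
                   + (if c == (N - r)%N :> nat then e else 0)).

(** The flip symmetry turns row N - r of X at column c into row r at column N - c, so the folded X
    only involves row r. On the other side Y reaches column c directly and through N - c. *)
Lemma foldmx_mul D N e (X Y : nat -> nat -> C) : (D <= N.+1)%N ->
  (forall r c, (r <= N)%N -> (c <= N)%N -> X (N - r)%N (N - c)%N = X r c) ->
  (forall r c, (r < D)%N -> (c <= N)%N ->
    (if (c < D)%N then Y r c else 0) + (if (N - c < D)%N then Y r (N - c)%N * e else 0)
      = X r c + e * X r (N - c)%N) ->
  foldmx D N e *m (\matrix_(r < N.+1, c < N.+1) X r c) =
  (\matrix_(r < D, c < D) Y r c) *m foldmx D N e.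
Proof.
move=> DN Xflip XY; apply/matrixP => r c.
have Hr := ltn_ord r; have Hc := ltn_ord c.
transitivity (X r c + e * X (N - r)%N c).
  rewrite mxE; under eq_bigr => k _ do rewrite !mxE mulrDl.
  rewrite big_split /=; congr (_ + _).
    transitivity (\sum_(k < N.+1) if k == r :> nat then X k c else 0).
      by apply: eq_bigr => k _; case: eqP; rewrite ?mul1r ?mul0r.
    by rewrite (sum_ord_eq _ _ (fun k => X k c)) ifT //; lia.
  transitivity (\sum_(k < N.+1) if k == (N - r)%N :> nat then e * X k c else 0).
    by apply: eq_bigr => k _; case: eqP; rewrite ?mul0r.
  by rewrite (sum_ord_eq _ _ (fun k => e * X k c)) ifT //; lia.
have -> : X (N - r)%N c = X r (N - c)%N.
  by rewrite -(Xflip r) ?subKn //; lia.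
rewrite -XY; [|lia|lia].
rewrite mxE; under [RHS]eq_bigr => k _ do rewrite !mxE mulrDr.
rewrite big_split /=; congr (_ + _).
  rewrite -(sum_ord_eq _ D (fun k => Y r k)).
  by apply: eq_bigr => k _; rewrite eq_sym; case: eqP; rewrite ?mulr1 ?mulr0.
rewrite -(sum_ord_eq _ D (fun k => Y r k * e)).
apply: eq_bigr => k _; have -> : (c == (N - k)%N :> nat) = (k == (N - c)%N :> nat).
  by have := ltn_ord k; lia.
by case: eqP; rewrite ?mulr0.
Qed.

(** From v_k - v_(N-k) = 0 and v_k + v_(N-k) = 0 follows 2 v_k = 0, so the columns are independent;
    d1 + d2 = N + 1 makes the matrix square. *)
Lemma col_foldmx_bij d1 d2 N (S := col_mx (foldmx d1 N (-1)) (foldmx d2 N 1)) :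
  (d1 <= d2 <= d1.+1)%N -> (d1 + d2 = N.+1)%N -> row_free S && row_full S.
Proof.
move=> d12 dN.
have Sfull : row_full S.
  rewrite /row_full -mxrank_tr; apply: inj_row_free => v.
  rewrite tr_col_mx mul_mx_row -row_mx0 => /eq_row_mx [v1 v2].
  have fold_entry D e (r : 'I_D) : (D <= N.+1)%N ->
    forall k k' : 'I_N.+1, k = r :> nat -> k' = (N - r)%N :> nat ->
    (v *m (foldmx D N e)^T) 0 r = v 0 k + e * v 0 k'.
    move=> DN k k' kr k'r; rewrite mxE.
    under eq_bigr => j _ do rewrite !mxE mulrDr.
    rewrite big_split /=; congr (_ + _).
      rewrite (bigD1 k) //= -kr eqxx mulr1 big1 ?addr0 // => j jk.
      by rewrite val_eqE (negPf jk) mulr0.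
    rewrite (bigD1 k') //= -k'r eqxx mulrC big1 ?addr0 // => j jk.
    by rewrite val_eqE (negPf jk) mulr0.
  have low (k : 'I_N.+1) : (k < d2)%N -> v 0 k = 0 /\ v 0 (rev_ord k) = 0.
    move=> kd2; have kN : (d2 <= N.+1)%N by lia.
    have := fold_entry d2 1 (Ordinal kd2) kN k (rev_ord k) erefl.
    rewrite v2 mxE mul1r /= subSS => /(_ erefl) /esym e2.
    case: (ltnP k d1) => kd1.
      have kN1 : (d1 <= N.+1)%N by lia.
      have := fold_entry d1 (-1) (Ordinal kd1) kN1 k (rev_ord k) erefl.
      rewrite v1 mxE mulN1r /= subSS => /(_ erefl) /esym e1.
      have : 2 * v 0 k = 0 by rewrite -[RHS](addr0 0) -{1}e1 -e2; ring.
      move/eqP; rewrite mulf_eq0 pnatr_eq0 /= => /eqP vk.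
      by split=> //; move: e2; rewrite vk add0r.
    (* The index fixed by the flip occurs only in the symmetric block, with entry 2. *)
    have rk : rev_ord k = k by apply: val_inj => /=; lia.
    move: e2; rewrite rk -mulr2n => /eqP; rewrite mulrn_eq0 /= => /eqP.
    by [].
  apply/rowP => k; rewrite mxE; case: (ltnP k d2) => kd2; first by case: (low k kd2).
  have := low (rev_ord k); rewrite rev_ordK /= => h; apply h.
  by have := ltn_ord k; lia.
rewrite Sfull andbT /row_free; move: Sfull; rewrite /row_full => /eqP ->.
by apply/eqP; lia.
Qed.

Lemma racah_fold N d1 d2 (XA XB Y1A Y1B Y2A Y2B : nat -> nat -> C) del :
  (d1 <= d2 <= d1.+1)%N -> (d1 + d2 = N.+1)%N ->
  foldmx d1 N (-1) *m (\matrix_(r, c) XA r c) = (\matrix_(r, c) Y1A r c) *m foldmx d1 N (-1) ->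
  foldmx d1 N (-1) *m (\matrix_(r, c) XB r c) = (\matrix_(r, c) Y1B r c) *m foldmx d1 N (-1) ->
  foldmx d2 N 1 *m (\matrix_(r, c) XA r c) = (\matrix_(r, c) Y2A r c) *m foldmx d2 N 1 ->
  foldmx d2 N 1 *m (\matrix_(r, c) XB r c) = (\matrix_(r, c) Y2B r c) *m foldmx d2 N 1 ->
  isoR (racah (\matrix_(r < N.+1, c < N.+1) XA r c) (\matrix_(r, c) XB r c) del)
   (dsum (racah (\matrix_(r < d1, c < d1) Y1A r c) (\matrix_(r, c) Y1B r c) del)
         (racah (\matrix_(r < d2, c < d2) Y2A r c) (\matrix_(r, c) Y2B r c) del)).
Proof.
move=> d12 dN h1A h1B h2A h2B; rewrite dsum_racah.
apply: (racah_iso _ _ _ _ _ _ _ _ (col_mx (foldmx d1 N (-1)) (foldmx d2 N 1))).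
- exact: col_foldmx_bij.
- by rewrite mul_col_mx mul_block_col !mul0mx addr0 add0r h1A h2A.
- by rewrite mul_col_mx mul_block_col !mul0mx addr0 add0r h1B h2B.
Qed.
End Folding.

(** * Identification with R_d(a,b,c) *)

Section Cases.
Variable C : numClosedFieldType.
Implicit Types (n d : nat) (a b c : C).

Definition Rtheta d a i : C := (a + d%:R / 2 - i%:R) * (a + d%:R / 2 - i%:R + 1).
Definition Rphi d a b c i : C :=
  i%:R * (i%:R - d%:R - 1) * (a + b + c + d%:R / 2 - i%:R + 2)
    * (a + b - c + d%:R / 2 - i%:R + 1).
Definition Rdel d a b c : C :=
  d%:R / 2 * (d%:R / 2 + 1) + a * (a + 1) + b * (b + 1) + c * (c + 1).

(** The factors met below are quarters of integers; after multiplication by 4 their nonvanishing is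
    decided by [lia] over [int]. *)
Lemma intr_neq0 (x : C) (z : int) : x * 4 = z%:~R -> z != 0 -> x != 0.
Proof.
by move=> xz z0; apply: contra_neq z0 => x0; apply/eqP; rewrite -(intr_eq0 C) -xz x0 mul0r.
Qed.

(** The value of [b] makes the eigenvalues of B in R_d(a,b,c) equal to ((n - 4i)^2 - 4)/16, and g =
    n/2. The condition n <> 2(j + k) separates these eigenvalues and, for j = k, keeps g - 2k
    nonzero. *)
Lemma Rmod_trimx n d a b c (sub diag sup : nat -> C) :
  b = n%:R / 4 - 2^-1 - d%:R / 2 ->
  Ldel C n = Rdel d a b c ->
  (forall j k, (j <= k <= d)%N -> (j < d)%N -> n <> 2 * (j + k))%N ->
  (forall j, (j < d)%N -> sub j != 0) ->
  (forall j, (0 < j <= d)%N -> sup j != 0) ->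
  (forall j, (0 < j <= d)%N -> Rphi d a b c j != 0) ->
  (forall i k (g : C), g = n%:R / 2 -> (i <= k <= d)%N ->
    diag k
    - (if (0 < k)%N then sub k.-1 * sup k * (k%:R - i%:R) * (g - 2 * k%:R + 2)
        * (g - 2 * k%:R + 1) / (Rphi d a b c k * (g - k%:R - i%:R + 1)) else 0)
    - (if (k < d)%N then Rphi d a b c k.+1 * (g - k%:R - i%:R)
        / ((k%:R - i%:R + 1) * (g - 2 * k%:R) * (g - 2 * k%:R - 1)) else 0)
    = Rtheta d a i - Rphi d a b c i / ((k%:R - i%:R + 1) * (g - k%:R - i%:R + 1))) ->
  isoR (racah (trimx d sub diag sup) (trimx d (fun=> 0) (Lthetas C n) (fun=> 0)) (Ldel C n))
    (Rmod C d a b c) /\ rirreducible (Rmod C d a b c).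
Proof.
move=> bE delE n_neq sub_neq0 sup_neq0 phi_neq0 recur.
have thetasB j k :
    Lthetas C n k - Lthetas C n j = (j%:R - k%:R) * (n%:R / 2 - k%:R - j%:R).
  by rewrite /Lthetas; field.
have g_neq j k : (j <= k <= d)%N -> (j < d)%N -> n%:R / 2 - k%:R - j%:R != 0 :> C.
  move=> jk jd; apply: (intr_neq0 _ (2 * n%:Z - 4 * k%:Z - 4 * j%:Z)); first by field.
  by have := n_neq j k jk jd; lia.
have phi0 : Rphi d a b c 0 = 0 by rewrite /Rphi !mul0r.
have PA := eigmxA C d sub diag sup (Rtheta d a) _ _ _ thetasB phi0 sub_neq0 phi_neq0
  g_neq (fun i k => recur i k _ erefl).
have PB := eigmxB C d sub _ (Rphi d a b c) _ thetasB sub_neq0 g_neq.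
have Pu := eigmx_unit C d sub (Lthetas C n) (Rphi d a b c) sub_neq0.
have iso : isoR (racah (trimx d sub diag sup)
    (trimx d (fun=> 0) (Lthetas C n) (fun=> 0)) (Ldel C n)) (Rmod C d a b c).
  have -> : Rmod C d a b c = racah (trimx d (fun=> 1) (Rtheta d a) (fun=> 0))
      (trimx d (fun=> 0) (Lthetas C n) (Rphi d a b c)) (Ldel C n).
    rewrite Rmod_racah delE; congr racah; apply/matrixP => i j; rewrite !mxE /tri.
    by case: eqP => // _; rewrite bE /Lthetas; field.
  by apply: racah_iso PA PB; rewrite row_free_unit row_full_unit Pu.
(* Irreducibility is proved on the tridiagonal side, where B is diagonal, and carried over. *)
split=> //; apply: irreducible_iso iso _.
by apply: trimx_irreducible => //; exact: (thetas_inj _ _ _ _ thetasB g_neq).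
Qed.
End Cases.

Ltac nz z := apply: (intr_neq0 _ _ z); [field|lia].

(** * The summands for each residue of n modulo 4 *)

Section Cases.
Variable C : numClosedFieldType.
Lemma Lsub_neq0 k : Lsub C k != 0.
Proof.
rewrite /Lsub; apply: mulf_neq0; last by rewrite invr_eq0 pnatr_eq0.
apply: mulf_neq0;
  [apply: (intr_neq0 _ _ (8 * k%:Z + 4)) | apply: (intr_neq0 _ _ (8 * k%:Z + 8))].
all: by [ring | lia].
Qed.

Lemma Lsup_neq0 n k : (2 * k <= n)%N -> Lsup C n k != 0.
Proof.
move=> kn; rewrite /Lsup; apply: mulf_neq0; last by rewrite invr_eq0 pnatr_eq0.
apply: mulf_neq0; [apply: (intr_neq0 _ _ (4 * n%:Z - 8 * k%:Z + 4))
  | apply: (intr_neq0 _ _ (4 * n%:Z - 8 * k%:Z + 8))].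
all: by [ring | lia].
Qed.

(** Here g = n/2 is a half-integer, so no g - k - j vanishes, and the whole even part is a single
    R_d. *)
Lemma Rmod_odd d (n := (2 * d).+1) :
  isoR (racah (trimx d (Lsub C) (Ldiag C n) (Lsup C n))
    (trimx d (fun=> 0) (Lthetas C n) (fun=> 0)) (Ldel C n))
    (Rmod C d (- (1/4)) (- (1/4)) (- (1/4)))
  /\ rirreducible (Rmod C d (- (1/4)) (- (1/4)) (- (1/4))).
Proof.
apply: Rmod_trimx.
- by rewrite /n; field.
- by rewrite /n /Ldel /Rdel; field.
- by move=> j k _ _; rewrite /n; lia.
- by move=> j _; apply: Lsub_neq0.
- by move=> j jd; apply: Lsup_neq0; rewrite /n; lia.
- move=> j jd; rewrite /Rphi; do !apply: mulf_neq0.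
  + by rewrite pnatr_eq0; lia.
  + by apply: (intr_neq0 _ _ (4 * j%:Z - 4 * d%:Z - 4)); [ring|lia].
  + by apply: (intr_neq0 _ _ (2 * d%:Z - 4 * j%:Z + 5)); [field|lia].
  + by apply: (intr_neq0 _ _ (2 * d%:Z - 4 * j%:Z + 3)); [field|lia].
- move=> i k _ -> ikd; rewrite {}/n.
  have h1 : k%:R - i%:R + 1 != 0 :> C by nz (4 * k%:Z - 4 * i%:Z + 4).
  have h2 : 2 * d%:R - 2 * k%:R - 2 * i%:R + 3 != 0 :> C
    by nz (8 * d%:Z - 8 * k%:Z - 8 * i%:Z + 12).
  have h3 : 2 * d%:R + 1 - 4 * k%:R != 0 :> C by nz (8 * d%:Z - 16 * k%:Z + 4).
  have h4 : 2 * d%:R - 1 - 4 * k%:R != 0 :> C by nz (8 * d%:Z - 16 * k%:Z - 4).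
  have h5 : 2 * d%:R + 5 - 4 * k%:R != 0 :> C by nz (8 * d%:Z - 16 * k%:Z + 20).
  have h6 : 2 * d%:R + 3 - 4 * k%:R != 0 :> C by nz (8 * d%:Z - 16 * k%:Z + 12).
  have h7 : k%:R - d%:R - 1 != 0 :> C by nz (4 * k%:Z - 4 * d%:Z - 4).
  rewrite /Rphi /Ldiag /Rtheta /Lsup /Lsub.
  (* At k = 0 and at k = d a conditional term drops out, so these cases go to [field] separately. *)
  case: (ltnP k d) => kd; last (have dk : d = k by lia); last subst d.
  all: case: k ikd kd h1 h2 h3 h4 h5 h6 h7 => [|k] ikd kd h1 h2 h3 h4 h5 h6 h7 /=.
  all: try (have i0 : i = 0%N by lia); try subst i.
  all: try (have k1 : k%:R + 1 != 0 :> C by nz (4 * k%:Z + 4)).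
  all: field.

  all: neq0_hyps.
Qed.

Lemma Rmod_zero :
  isoR (racah (trimx 0 (Lsub C) (Ldiag C 0) (Lsup C 0))
    (trimx 0 (fun=> 0) (Lthetas C 0) (fun=> 0)) (Ldel C 0))
    (Rmod C 0 (- (1/2)) (- (1/2)) (- (1/2)))
  /\ rirreducible (Rmod C 0 (- (1/2)) (- (1/2)) (- (1/2))).
Proof.
apply: Rmod_trimx => //.
- by field.
- by rewrite /Ldel /Rdel; field.
- by move=> j; lia.
- by move=> j; lia.
- move=> i k _ -> ik0; have -> : k = 0%N by lia. have -> : i = 0%N by lia.
  by rewrite /Rphi /Ldiag /Rtheta /=; field.
Qed.

(** The antisymmetric fold sends the middle vector, of index d + 1, to 0, so A is truncated without
    a boundary correction. *)
Lemma Rmod_mod4_0_anti d (n := (4 * d.+1)%N) :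
  isoR (racah (trimx d (Lsub C) (Ldiag C n) (Lsup C n))
    (trimx d (fun=> 0) (Lthetas C n) (fun=> 0)) (Ldel C n))
    (Rmod C d ((n%:R - 4) / 8) (n%:R / 8) ((n%:R - 4) / 8))
  /\ rirreducible (Rmod C d ((n%:R - 4) / 8) (n%:R / 8) ((n%:R - 4) / 8)).
Proof.
apply: Rmod_trimx.
- by rewrite /n; field.
- by rewrite /n /Ldel /Rdel; field.
- by move=> j k jk jd; rewrite /n; lia.
- by move=> j _; apply: Lsub_neq0.
- by move=> j jd; apply: Lsup_neq0; rewrite /n; lia.
- move=> j jd; rewrite /Rphi /n; do !apply: mulf_neq0.
  + by rewrite pnatr_eq0; lia.
  + by nz (4 * j%:Z - 4 * d%:Z - 4).
  + by nz (8 * d%:Z - 4 * j%:Z + 10).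
  + by nz (4 * d%:Z - 4 * j%:Z + 6).
- move=> i k _ -> ikd; rewrite {}/n.
  have h1 : k%:R - i%:R + 1 != 0 :> C by nz (4 * k%:Z - 4 * i%:Z + 4).
  have h2 : 2 * d%:R + 3 - k%:R - i%:R != 0 :> C by nz (8 * d%:Z + 12 - 4 * k%:Z - 4 * i%:Z).
  have h3 : d%:R + 1 - k%:R != 0 :> C by nz (4 * d%:Z - 4 * k%:Z + 4).
  have h4 : 2 * d%:R + 1 - 2 * k%:R != 0 :> C by nz (8 * d%:Z - 8 * k%:Z + 4).
  have h5 : 4 * d%:R + 5 - 2 * k%:R != 0 :> C by nz (16 * d%:Z - 8 * k%:Z + 20).
  have h6 : 2 * d%:R + 3 - 2 * k%:R != 0 :> C by nz (8 * d%:Z - 8 * k%:Z + 12).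
  rewrite /Rphi /Ldiag /Rtheta /Lsup /Lsub.
  case: (ltnP k d) => kd; last (have dk : d = k by lia); last subst d.
  all: case: k ikd kd h1 h2 h3 h4 h5 h6 => [|k] ikd kd h1 h2 h3 h4 h5 h6 /=.
  all: try (have i0 : i = 0%N by lia); try subst i.
  all: try (have k1 : k%:R + 1 != 0 :> C by nz (4 * k%:Z + 4)).
  all: field; neq0_hyps.
Qed.

(* The doubled subdiagonal entry comes from the fixed vector of the flip, which
   [foldmx] counts twice. *)
Lemma Rmod_mod4_0_sym d (n := (4 * d)%N) :
  (0 < d)%N ->
  isoR (racah (trimx d (fun k => if k.+1 == d then 2 * Lsub C k else Lsub C k)
      (Ldiag C n) (Lsup C n))
    (trimx d (fun=> 0) (Lthetas C n) (fun=> 0)) (Ldel C n))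
    (Rmod C d ((n%:R - 4) / 8) ((n%:R - 4) / 8) ((n%:R - 4) / 8))
  /\ rirreducible (Rmod C d ((n%:R - 4) / 8) ((n%:R - 4) / 8) ((n%:R - 4) / 8)).
Proof.
move=> d_gt0; apply: Rmod_trimx.
- by rewrite /n; field.
- by rewrite /n /Ldel /Rdel; field.
- by move=> j k jk jd; rewrite /n; lia.
- move=> j _; case: ifP => _; last exact: Lsub_neq0.
  by apply: mulf_neq0; rewrite ?pnatr_eq0 ?Lsub_neq0.
- by move=> j jd; apply: Lsup_neq0; rewrite /n; lia.
- move=> j jd; rewrite /Rphi /n; do !apply: mulf_neq0.
  + by rewrite pnatr_eq0; lia.
  + by nz (4 * j%:Z - 4 * d%:Z - 4).
  + by nz (8 * d%:Z - 4 * j%:Z + 2).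
  + by nz (4 * d%:Z - 4 * j%:Z + 2).
- move=> i k _ -> ikd; rewrite {}/n.
  have h1 : k%:R - i%:R + 1 != 0 :> C by nz (4 * k%:Z - 4 * i%:Z + 4).
  have h2 : 2 * d%:R + 1 - k%:R - i%:R != 0 :> C by nz (8 * d%:Z + 4 - 4 * k%:Z - 4 * i%:Z).
  have h3 : (k < d)%N -> d%:R - k%:R != 0 :> C by move=> kd; nz (4 * d%:Z - 4 * k%:Z).
  have h4 : 2 * d%:R - 1 - 2 * k%:R != 0 :> C by nz (8 * d%:Z - 8 * k%:Z - 4).
  have h5 : 4 * d%:R + 1 - 2 * k%:R != 0 :> C by nz (16 * d%:Z - 8 * k%:Z + 4).
  have h6 : 2 * d%:R + 1 - 2 * k%:R != 0 :> C by nz (8 * d%:Z - 8 * k%:Z + 4).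
  have h7 : d%:R + 1 - k%:R != 0 :> C by nz (4 * d%:Z - 4 * k%:Z + 4).
  rewrite /Rphi /Ldiag /Rtheta /Lsup /Lsub.
  case: (ltnP k d) => kd; last (have dk : d = k by lia).
    have {}h3 := h3 kd.
    case: k ikd kd h1 h2 h3 h4 h5 h6 h7 => [|k] ikd kd h1 h2 h3 h4 h5 h6 h7 /=.
      by (have -> : i = 0%N by lia); field; neq0_hyps.
    have -> : (k.+1 == d) = false by lia.
    have k1 : k%:R + 1 != 0 :> C by nz (4 * k%:Z + 4).
    by field; neq0_hyps.
  (* At k = d the entry [sub k.-1] is the doubled one, and d > 0 rules out k = 0. *)
  subst d.
  case: k ikd kd h1 h2 h3 h4 h5 h6 h7 d_gt0 =>
    [|k] ikd kd h1 h2 h3 h4 h5 h6 h7 // _; rewrite eqxx /=.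
  have k1 : k%:R + 1 != 0 :> C by nz (4 * k%:Z + 4).
  by field; neq0_hyps.
Qed.

(** The flip of 0, ..., 2d + 1 has no fixed index but exchanges d and d + 1, so the entry of A
    between these two is folded onto the last diagonal entry, with sign -1. *)
Lemma Rmod_mod4_2_anti d (n := (4 * d + 2)%N) :
  isoR (racah (trimx d (Lsub C)
      (fun k => if k == d then Ldiag C n k - Lsub C k else Ldiag C n k) (Lsup C n))
    (trimx d (fun=> 0) (Lthetas C n) (fun=> 0)) (Ldel C n))
    (Rmod C d ((n%:R - 6) / 8) ((n%:R - 2) / 8) ((n%:R - 2) / 8))
  /\ rirreducible (Rmod C d ((n%:R - 6) / 8) ((n%:R - 2) / 8) ((n%:R - 2) / 8)).
Proof.
apply: Rmod_trimx.
- by rewrite /n; field.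
- by rewrite /n /Ldel /Rdel; field.
- by move=> j k jk jd; rewrite /n; lia.
- by move=> j _; apply: Lsub_neq0.
- by move=> j jd; apply: Lsup_neq0; rewrite /n; lia.
- move=> j jd; rewrite /Rphi /n; do !apply: mulf_neq0.
  + by rewrite pnatr_eq0; lia.
  + by nz (4 * j%:Z - 4 * d%:Z - 4).
  + by nz (8 * d%:Z - 4 * j%:Z + 6).
  + by nz (4 * d%:Z - 4 * j%:Z + 2).
- move=> i k _ -> ikd; rewrite {}/n.
  have h1 : k%:R - i%:R + 1 != 0 :> C by nz (4 * k%:Z - 4 * i%:Z + 4).
  have h2 : 2 * d%:R + 2 - k%:R - i%:R != 0 :> C by nz (8 * d%:Z + 8 - 4 * k%:Z - 4 * i%:Z).
  have h3 : (k < d)%N -> d%:R - k%:R != 0 :> C by move=> kd; nz (4 * d%:Z - 4 * k%:Z).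
  have h4 : 2 * d%:R + 1 - 2 * k%:R != 0 :> C by nz (8 * d%:Z - 8 * k%:Z + 4).
  have h5 : 4 * d%:R + 3 - 2 * k%:R != 0 :> C by nz (16 * d%:Z - 8 * k%:Z + 12).
  have h6 : d%:R + 1 - k%:R != 0 :> C by nz (4 * d%:Z - 4 * k%:Z + 4).
  rewrite /Rphi /Ldiag /Rtheta /Lsup /Lsub.
  case: (ltnP k d) => kd; [have -> : (k == d) = false by lia
    | have dk : d = k by lia].
    have {}h3 := h3 kd.
    case: k ikd kd h1 h2 h3 h4 h5 h6 => [|k] ikd kd h1 h2 h3 h4 h5 h6 /=.
      by (have -> : i = 0%N by lia); field; neq0_hyps.
    have k1 : k%:R + 1 != 0 :> C by nz (4 * k%:Z + 4).
    by field; neq0_hyps.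
  subst d; rewrite eqxx.
  case: k ikd kd h1 h2 h3 h4 h5 h6 => [|k] ikd kd h1 h2 h3 h4 h5 h6 /=.
    by (have -> : i = 0%N by lia); field.
  have k1 : k%:R + 1 != 0 :> C by nz (4 * k%:Z + 4).
  by field; neq0_hyps.
Qed.

(** The correction of the last diagonal entry now has sign +1, which exchanges the parameters a and
    c of the antisymmetric summand. *)
Lemma Rmod_mod4_2_sym d (n := (4 * d + 2)%N) :
  isoR (racah (trimx d (Lsub C)
      (fun k => if k == d then Ldiag C n k + Lsub C k else Ldiag C n k) (Lsup C n))
    (trimx d (fun=> 0) (Lthetas C n) (fun=> 0)) (Ldel C n))
    (Rmod C d ((n%:R - 2) / 8) ((n%:R - 2) / 8) ((n%:R - 6) / 8))
  /\ rirreducible (Rmod C d ((n%:R - 2) / 8) ((n%:R - 2) / 8) ((n%:R - 6) / 8)).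
Proof.
apply: Rmod_trimx.
- by rewrite /n; field.
- by rewrite /n /Ldel /Rdel; field.
- by move=> j k jk jd; rewrite /n; lia.
- by move=> j _; apply: Lsub_neq0.
- by move=> j jd; apply: Lsup_neq0; rewrite /n; lia.
- move=> j jd; rewrite /Rphi /n; do !apply: mulf_neq0.
  + by rewrite pnatr_eq0; lia.
  + by nz (4 * j%:Z - 4 * d%:Z - 4).
  + by nz (8 * d%:Z - 4 * j%:Z + 6).
  + by nz (4 * d%:Z - 4 * j%:Z + 6).
- move=> i k _ -> ikd; rewrite {}/n.
  have h1 : k%:R - i%:R + 1 != 0 :> C by nz (4 * k%:Z - 4 * i%:Z + 4).
  have h2 : 2 * d%:R + 2 - k%:R - i%:R != 0 :> C by nz (8 * d%:Z + 8 - 4 * k%:Z - 4 * i%:Z).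
  have h3 : (k < d)%N -> d%:R - k%:R != 0 :> C by move=> kd; nz (4 * d%:Z - 4 * k%:Z).
  have h4 : 2 * d%:R + 1 - 2 * k%:R != 0 :> C by nz (8 * d%:Z - 8 * k%:Z + 4).
  have h5 : 4 * d%:R + 3 - 2 * k%:R != 0 :> C by nz (16 * d%:Z - 8 * k%:Z + 12).
  have h6 : d%:R + 1 - k%:R != 0 :> C by nz (4 * d%:Z - 4 * k%:Z + 4).
  have h7 : 2 * d%:R + 3 - 2 * k%:R != 0 :> C by nz (8 * d%:Z - 8 * k%:Z + 12).
  rewrite /Rphi /Ldiag /Rtheta /Lsup /Lsub.
  case: (ltnP k d) => kd; [have -> : (k == d) = false by lia
    | have dk : d = k by lia].
    have {}h3 := h3 kd.
    case: k ikd kd h1 h2 h3 h4 h5 h6 h7 => [|k] ikd kd h1 h2 h3 h4 h5 h6 h7 /=.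
      by (have -> : i = 0%N by lia); field; neq0_hyps.
    have k1 : k%:R + 1 != 0 :> C by nz (4 * k%:Z + 4).
    by field; neq0_hyps.
  subst d; rewrite eqxx.
  case: k ikd kd h1 h2 h3 h4 h5 h6 h7 => [|k] ikd kd h1 h2 h3 h4 h5 h6 h7 /=.
    by (have -> : i = 0%N by lia); field.
  have k1 : k%:R + 1 != 0 :> C by nz (4 * k%:Z + 4).
  by field; neq0_hyps.
Qed.
End Cases.

(** * The flip and the folds of A and B for even n *)

Section Folds.
Variable C : numClosedFieldType.

Lemma tri_far (sub diag sup : nat -> C) r c : (r.+1 < c)%N -> tri sub diag sup r c = 0.
Proof. by move=> rc; rewrite /tri; repeat (case: ifP => ?; first lia). Qed.

(** The flip v_i <-> v_(n-i) exchanges E and F; for n = 2N it acts on the vectors v_(2k) by k <-> N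
    - k. *)
Lemma Lsup_flip N k : (k < N)%N -> Lsup C (2 * N) (N - k) = Lsub C k.
Proof. by move=> kN; rewrite /Lsup /Lsub natrB ?(ltnW kN) //; field. Qed.

Lemma Lsub_flip N k : (0 < k <= N)%N -> Lsub C (N - k) = Lsup C (2 * N) k.
Proof. by move=> kN; rewrite /Lsup /Lsub natrB; [field | lia]. Qed.

Lemma LA_flip N r c : (r <= N)%N -> (c <= N)%N ->
  tri (Lsub C) (Ldiag C (2 * N)) (Lsup C (2 * N)) (N - r) (N - c) =
  tri (Lsub C) (Ldiag C (2 * N)) (Lsup C (2 * N)) r c.
Proof.
move=> rN cN; rewrite !triE.
have -> : (N - r == N - c)%N = (r == c) by lia.
have -> : (N - r == (N - c).+1)%N = (r.+1 == c) by lia.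
have -> : ((N - r).+1 == N - c)%N = (r == c.+1) by lia.
rewrite addrAC; congr (_ + _ + _); case: eqP => // h.
- by rewrite /Ldiag natrB //; field.
- by rewrite Lsup_flip //; lia.
- by rewrite Lsub_flip //; lia.
Qed.

Lemma LB_flip N r c : (r <= N)%N -> (c <= N)%N ->
  tri (fun=> 0) (Lthetas C (2 * N)) (fun=> 0) (N - r) (N - c) =
  tri (fun=> 0) (Lthetas C (2 * N)) (fun=> 0) r c.
Proof.
move=> rN cN; rewrite /tri !if_same.
have -> : (N - r == N - c)%N = (r == c) by lia.
by case: eqP => // _; rewrite /Lthetas natrB //; field.
Qed.

(** Three sizes occur: 2D = N omits the middle index (antisymmetric), 2D = N + 1 has no middle
    index, and 2D = N + 2 includes it (symmetric). By the flip, only columns of the first half need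
    checking. *)
Lemma foldmx_mul_half D N (e : C) (X Y : nat -> nat -> C) :
  (N <= 2 * D <= N.+2)%N -> e * e = 1 ->
  ((2 * D)%N = N -> e = -1) -> ((2 * D)%N = N.+2 -> e = 1) ->
  (forall r c, (r <= N)%N -> (c <= N)%N -> X (N - r)%N (N - c)%N = X r c) ->
  (forall r c, (r < D)%N -> (c < D)%N -> (c + D <= N)%N ->
     Y r c = X r c + e * X r (N - c)%N) ->
  (forall r, (r < D)%N -> (2 * D)%N = N.+2 -> Y r D.-1 = X r D.-1) ->
  foldmx C D N e *m (\matrix_(r < N.+1, c < N.+1) X r c) =
  (\matrix_(r < D, c < D) Y r c) *m foldmx C D N e.
Proof.
move=> DN ee eN1 e1 Xflip XY XYmid; apply: foldmx_mul => //; first lia.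
(* The four cases in order: c is the included middle index, c lies in the first half, c lies in the
   second half (where e * e = 1 is used), c is the omitted middle index. *)
move=> r c rD cN; case: (ltnP c D) => cD; case: (ltnP (N - c) D) => NcD.
- have -> : (N - c)%N = D.-1 by lia.
  have -> : c = D.-1 by lia.
  have DN2 : (2 * D)%N = N.+2 by lia.
  by rewrite XYmid // e1 // mulr1 mul1r.
- by rewrite addr0 XY //; lia.
- rewrite add0r XY //; [|lia].
  by rewrite subKn // mulrDl addrC mulrAC ee mul1r [e * _]mulrC.
- have -> : (N - c)%N = c by lia.
  by rewrite eN1; [ring | lia].
Qed.

Lemma foldB D N (e : C) : (N <= 2 * D <= N.+2)%N -> e * e = 1 ->
  ((2 * D)%N = N -> e = -1) -> ((2 * D)%N = N.+2 -> e = 1) ->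
  foldmx C D N e *m (\matrix_(r < N.+1, c < N.+1)
    tri (fun=> 0) (Lthetas C (2 * N)) (fun=> 0) r c) =
  (\matrix_(r < D, c < D) tri (fun=> 0) (Lthetas C (2 * N)) (fun=> 0) r c)
    *m foldmx C D N e.
Proof.
move=> DN ee eN1 e1; apply: foldmx_mul_half => //; first exact: LB_flip.
move=> r c rD cD cDN; rewrite /tri !if_same.
by rewrite (_ : (r == N - c)%N = false) ?mulr0 ?addr0 //; lia.
Qed.

Lemma foldA_mod4_0_anti d (N := (2 * d)%N) :
  foldmx C d N (-1) *m (\matrix_(r < N.+1, c < N.+1)
    tri (Lsub C) (Ldiag C (2 * N)) (Lsup C (2 * N)) r c) =
  (\matrix_(r < d, c < d) tri (Lsub C) (Ldiag C (2 * N)) (Lsup C (2 * N)) r c)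
    *m foldmx C d N (-1).
Proof.
apply: foldmx_mul_half => //; try (rewrite /N; lia); first by ring.
  exact: LA_flip.
by move=> r c rd cd _; rewrite (tri_far _ _ _ r (N - c)) ?mulr0 ?addr0 // /N; lia.
Qed.

Lemma foldA_mod4_0_sym d (N := (2 * d)%N) :
  foldmx C d.+1 N 1 *m (\matrix_(r < N.+1, c < N.+1)
    tri (Lsub C) (Ldiag C (2 * N)) (Lsup C (2 * N)) r c) =
  (\matrix_(r < d.+1, c < d.+1)
    tri (fun k => if k.+1 == d then 2 * Lsub C k else Lsub C k)
     (Ldiag C (2 * N)) (Lsup C (2 * N)) r c) *m foldmx C d.+1 N 1.
Proof.
apply: foldmx_mul_half => //; try (rewrite /N; lia); first by ring.
- exact: LA_flip.
- move=> r c rd cd cdN; rewrite mul1r.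
  case: (ltnP r.+1 (N - c)) => h.
    rewrite (tri_far _ _ _ r (N - c)) // addr0 /tri; case: ifP => // _.
    by case: ifP => // ?; rewrite ifF //; move: h; rewrite /N; lia.
  (* Only row d and column d - 1 remain: the reflected column d + 1 is adjacent to row d, and its
     entry equals the subdiagonal one by [Lsup_flip], hence the doubling. *)
  have -> : r = d by move: h cdN; rewrite /N; lia.
  have cE : c.+1 = d by move: h cdN; rewrite /N; lia.
  rewrite /tri cE !eqxx.
  have -> : (d == c) = false by lia.
  have -> : (d == N - c)%N = false by rewrite /N; lia.
  have -> : (d == (N - c).+1)%N = false by rewrite /N; lia.
  have -> : (d.+1 == N - c)%N by rewrite /N; lia.
  by rewrite Lsup_flip; [ring | rewrite /N; lia].
- move=> r rd _ /=; rewrite /tri; case: ifP => // _; case: ifP => // _.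
  by rewrite ifF //; lia.
Qed.

Lemma foldA_mod4_2 d (e : C) (N := (2 * d).+1) : e * e = 1 ->
  foldmx C d.+1 N e *m (\matrix_(r < N.+1, c < N.+1)
    tri (Lsub C) (Ldiag C (2 * N)) (Lsup C (2 * N)) r c) =
  (\matrix_(r < d.+1, c < d.+1) tri (Lsub C)
    (fun k => if k == d then Ldiag C (2 * N) k + e * Lsub C k else Ldiag C (2 * N) k)
     (Lsup C (2 * N)) r c) *m foldmx C d.+1 N e.
Proof.
move=> ee; apply: foldmx_mul_half => //; try (rewrite /N; lia).
- exact: LA_flip.
- move=> r c rd cd cdN.
  case: (ltnP r.+1 (N - c)) => h.
    rewrite (tri_far _ _ _ r (N - c)) // mulr0 addr0 /tri; case: ifP => // ?.
    by rewrite ifF //; move: h; rewrite /N; lia.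
  (* Only row d and column d remain, with reflected column d + 1. *)
  have -> : r = d by move: h cdN; rewrite /N; lia.
  have cE : c = d by move: h cdN; rewrite /N; lia.
  rewrite cE /tri !eqxx; do 2 (rewrite ifF; last by rewrite /N; lia).
  by rewrite ifT ?Lsup_flip //; rewrite /N; lia.
Qed.
End Folds.

(** * Assembly of the four cases *)

Theorem theorem7p3 (C : numClosedFieldType) (n : nat) :
  [/\
   (* (i) *)
   odd n ->
     rirreducible (Rmod C (n.-1 %/ 2) (- (1/4)) (- (1/4)) (- (1/4))) /\
     isoR (Lmod0 C n) (Rmod C (n.-1 %/ 2) (- (1/4)) (- (1/4)) (- (1/4))),
   (* (ii) *)
   n = 0%N ->
     rirreducible (Rmod C 0 (- (1/2)) (- (1/2)) (- (1/2))) /\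
     isoR (Lmod0 C n) (Rmod C 0 (- (1/2)) (- (1/2)) (- (1/2))),
   (* (iii) *)
   n <> 0%N -> (4 %| n)%N ->
     [/\ rirreducible (Rmod C (n %/ 4).-1 ((n%:R - 4) / 8) (n%:R / 8) ((n%:R - 4) / 8)),
         rirreducible (Rmod C (n %/ 4) ((n%:R - 4) / 8) ((n%:R - 4) / 8) ((n%:R - 4) / 8)) &
         isoR (Lmod0 C n)
           (dsum (Rmod C (n %/ 4).-1 ((n%:R - 4) / 8) (n%:R / 8) ((n%:R - 4) / 8))
                 (Rmod C (n %/ 4) ((n%:R - 4) / 8) ((n%:R - 4) / 8) ((n%:R - 4) / 8)))] &
   (* (iv) *)
   (n %% 4 = 2)%N ->
     [/\ rirreducible (Rmod C (n.-2 %/ 4) ((n%:R - 6) / 8) ((n%:R - 2) / 8) ((n%:R - 2) / 8)),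
         rirreducible (Rmod C (n.-2 %/ 4) ((n%:R - 2) / 8) ((n%:R - 2) / 8) ((n%:R - 6) / 8)) &
         isoR (Lmod0 C n)
           (dsum (Rmod C (n.-2 %/ 4) ((n%:R - 6) / 8) ((n%:R - 2) / 8) ((n%:R - 2) / 8))
                 (Rmod C (n.-2 %/ 4) ((n%:R - 2) / 8) ((n%:R - 2) / 8) ((n%:R - 6) / 8)))]].
Proof.
split.
- move=> n_odd; have [d nE] : exists d, n = (2 * d).+1 by exists n./2; lia.
  have -> : (n.-1 %/ 2)%N = d by lia.
  rewrite Lmod0E (_ : n./2 = d); last lia.
  by rewrite nE; have [] := Rmod_odd C d.
- by move=> ->; rewrite Lmod0E; have [] := Rmod_zero C.
- move=> n0 n4; have [d nE] : exists d, n = (4 * d.+1)%N by exists (n %/ 4).-1; lia.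
  have -> : (n %/ 4)%N = d.+1 by lia.
  rewrite /= Lmod0E (_ : n./2 = (2 * d.+1)%N); last lia.
  rewrite nE; have [iso1 irr1] := Rmod_mod4_0_anti C d.
  have [iso2 irr2] := Rmod_mod4_0_sym C d.+1 isT.
  split=> //; apply: isoR_trans (isoR_dsum _ _ _ _ _ _ _ _ _ iso1 iso2).
  (* The folds are stated for L_(2N), so n is rewritten as 2N with N = [n./2]. *)
  have -> : (4 * d.+1 = 2 * (2 * d.+1))%N by lia.
  apply: racah_fold; try lia.
  + exact: foldA_mod4_0_anti.
  + by apply: foldB => //; try lia; ring.
  + exact: foldA_mod4_0_sym.
  + by apply: foldB => //; try lia; ring.
- move=> n4; have [d nE] : exists d, n = (4 * d + 2)%N by exists (n %/ 4)%N; lia.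
  have -> : (n.-2 %/ 4)%N = d by lia.
  rewrite /= Lmod0E (_ : n./2 = (2 * d).+1); last lia.
  rewrite nE; have [iso1 irr1] := Rmod_mod4_2_anti C d.
  have [iso2 irr2] := Rmod_mod4_2_sym C d.
  split=> //; apply: isoR_trans (isoR_dsum _ _ _ _ _ _ _ _ _ iso1 iso2).
  have -> : (4 * d + 2 = 2 * (2 * d).+1)%N by lia.
  apply: racah_fold; try lia.
  + rewrite foldA_mod4_2; last by ring.
    by congr (_ *m _); apply/matrixP => i j; rewrite !mxE /tri mulN1r.
  + by apply: foldB => //; try lia; ring.
  + rewrite foldA_mod4_2; last by ring.
    by congr (_ *m _); apply/matrixP => i j; rewrite !mxE /tri mul1r.
  + by apply: foldB => //; try lia; ring.
Qed.
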